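(* Let $A$ be a commutative ring with identity, let $d$ be a non-negative integer, and let $R=A[\mathbb{R}_{\geq 0}^d]$ be the semigroup ring of the additive semigroup $\mathbb{R}_{\geq 0}^d$ over $A$. A monomial ideal $I$ of $R$ has a finite m-irreducible decomposition if and only if it is almost finitely generated, that is, if and only if it can be expressed as a finite sum of ideals of the form $I_{\underline{\alpha},\underline{\varepsilon}}$ with $\underline{\alpha}\in\mathbb{R}_{\infty\geq 0}^d$ and $\underline{\varepsilon}\in\mathbb{Z}_2^d$.
   Context: $\mathbb{R}_{\geq 0}=\{r\in\mathbb{R}\mid r\geq 0\}$, $\mathbb{R}_{\infty\geq 0}=\mathbb{R}_{\geq 0}\cup\{\infty\}$, $\mathbb{R}_{\infty\geq 0}^d=(\mathbb{R}_{\infty\geq 0})^d$, $\mathbb{Z}_2=\{0,1\}$. The ring $R=A[\mathbb{R}_{\geq 0}^d]$ is thought of as the set of all polynomials in $X_1,\ldots,X_d$ with coefficients in $A$ and non-negative real exponents. A monomial is an element $\underline{X}^{\underline{r}}=X_1^{r_1}\cdots X_d^{r_d}$ with $\underline{r}=(r_1,\ldots,r_d)\in\mathbb{R}_{\geq 0}^d$. A monomial ideal of $R$ is an ideal generated by a (possibly empty, possibly infinite) set of monomials. A monomial ideal $I$ is m-irreducible if for all monomial ideals $J,K$ of $R$ with $I=J\cap K$, either $I=J$ or $I=K$. A finite m-irreducible decomposition of $I$ is an expression $I=\bigcap_{\lambda\in\Lambda}I_\lambda$ with $\Lambda$ finite and each $I_\lambda$ an m-irreducible monomial ideal of $R$.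 For $\varepsilon\in\mathbb{Z}_2$ and $r,\alpha\in\mathbb{R}$, write $r\geq_\varepsilon\alpha$ to mean $r\geq\alpha$ if $\varepsilon=0$ and $r>\alpha$ if $\varepsilon=1$; also $s\geq_\varepsilon\infty$ means $s=\infty$. By convention $X_i^\infty=0$. For $\underline{\alpha}=(\alpha_1,\ldots,\alpha_d)\in\mathbb{R}_{\infty\geq 0}^d$ and $\underline{\varepsilon}=(\varepsilon_1,\ldots,\varepsilon_d)\in\mathbb{Z}_2^d$, set $I_{\underline{\alpha},\underline{\varepsilon}}=\left(\{\underline{X}^{\underline{r}}\mid r_i\geq_{\varepsilon_i}\alpha_i\text{ for all }i=1,\ldots,d\}\right)R$; in particular $I_{\underline{\alpha},\underline{\varepsilon}}=0$ if some $\alpha_i=\infty$. Empty sums of ideals are the zero ideal and empty intersections are the unit ideal. *)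

(* Defs.v *)
From HB Require Import structures.
From mathcomp Require Import all_boot all_order all_algebra.
(* monalg has to come before constructive_ereal: in the other order their
   notations at level 2 are rejected. *)
From mathcomp Require Import finmap xfinmap monalg.
From mathcomp Require Import boolp classical_sets reals constructive_ereal.

Set Implicit Arguments.
Unset Strict Implicit.
Unset Printing Implicit Defensive.

Import Order.TTheory GRing.Theory Num.Theory.
Local Open Scope ring_scope.
Local Open Scope classical_set_scope.

(* The ring instance that monalg puts on {malg A[M]} requires A to be nonzero.
   Here A may be the zero ring, so {malg A[M]} is aliased and given the same
   multiplication over an arbitrary commutative ring. *)
Definition monoid_ring (A : comPzRingType) (M : conomType) : Type :=
  {malg A[M]}.

HB.instance Definition _ (A : comPzRingType) (M : conomType) :=
  GRing.Zmodule.on (monoid_ring A M).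

Section MonoidRing.
Context (A : comPzRingType) (M : conomType).
Implicit Types f g h : monoid_ring A M.

Definition mring_one : monoid_ring A M := << 1 *g mone >>.

Definition mring_mul f g : monoid_ring A M :=
  \sum_(k <- msupp f) \sum_(l <- msupp g) << f@_k * g@_l *g mmul k l >>.

Lemma mring_mulw (D E : {fset M}) f g :
  (msupp f `<=` D)%fset -> (msupp g `<=` E)%fset ->
  mring_mul f g =
    \sum_(k <- D) \sum_(l <- E) << f@_k * g@_l *g mmul k l >>.
Proof.
move=> fD gE; rewrite /mring_mul (big_fset_incl _ fD) /=.
  apply: eq_bigr => k _; apply: big_fset_incl => // l _ /mcoeff_outdom ->.
  by rewrite mulr0 monalgU0.
move=> k _ /mcoeff_outdom fk; rewrite big1 // => l _.
by rewrite fk mul0r monalgU0.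
Qed.

Lemma mring_mulUU (a b : A) (k l : M) :
  mring_mul << a *g k >> << b *g l >> = << a * b *g mmul k l >>.
Proof. by rewrite (mring_mulw msuppU_le msuppU_le) !big_seq_fset1 !mcoeffUU. Qed.

Lemma mring_mulC : commutative mring_mul.
Proof.
move=> f g; rewrite /mring_mul exchange_big /=.
by apply: eq_bigr => k _; apply: eq_bigr => l _; rewrite mulrC mulmC.
Qed.

Lemma mring_mulDl : left_distributive mring_mul +%R.
Proof.
move=> f g h; have hh := fsubset_refl (msupp h).
rewrite (mring_mulw (msuppD_le f g) hh).
rewrite (mring_mulw (fsubsetUl (msupp f) (msupp g)) hh).
rewrite (mring_mulw (fsubsetUr (msupp f) (msupp g)) hh) -big_split /=.
apply: eq_bigr => k _; rewrite -big_split /=; apply: eq_bigr => l _.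
by rewrite mcoeffD mulrDl monalgUD.
Qed.

Lemma mring_mul1 : left_id mring_one mring_mul.
Proof.
move=> f; rewrite (mring_mulw msuppU_le (fsubset_refl _)) big_seq_fset1.
rewrite [RHS]monalgE; apply: eq_bigr => k _.
by rewrite mcoeffUU mul1r mul1m.
Qed.

Lemma mring_mulA : associative mring_mul.
Proof.
have mul0 f : mring_mul 0 f = 0 by rewrite /mring_mul msupp0 big_seq_fset0.
have sumr I (r : seq I) (F : I -> monoid_ring A M) g :
    mring_mul (\sum_(i <- r) F i) g = \sum_(i <- r) mring_mul (F i) g.
  exact: (big_morph (mring_mul^~ g) (fun _ _ => mring_mulDl _ _ _) (mul0 _)).
have suml I (r : seq I) (F : I -> monoid_ring A M) f :
    mring_mul f (\sum_(i <- r) F i) = \sum_(i <- r) mring_mul f (F i).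
  rewrite mring_mulC sumr; apply: eq_bigr => i _; exact: mring_mulC.
move=> f g h; rewrite [f]monalgE !(sumr _ (msupp f)); apply: eq_bigr => i _.
rewrite [g]monalgE (suml _ (msupp g)) !(sumr _ (msupp g)) suml.
apply: eq_bigr => j _.
rewrite [h]monalgE !(suml _ (msupp h)); apply: eq_bigr => k _.
by rewrite !mring_mulUU mulrA mulmA.
Qed.

HB.instance Definition _ := GRing.Zmodule_isComPzRing.Build (monoid_ring A M)
  mring_mulA mring_mulC mring_mul1 mring_mulDl.

End MonoidRing.

Section Exponent.
Context (R : realType) (d : nat).

Record exponent : predArgType := Exponent {
  exponent_val :> {ffun 'I_d -> R};
  exponent_ge0 : [forall i, 0 <= exponent_val i]
}.

HB.instance Definition _ := [isSub for exponent_val].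
HB.instance Definition _ := [Choice of exponent by <:].

Fact exponent0_ge0 : [forall i, 0 <= (0 : {ffun 'I_d -> R}) i].
Proof. by apply/forallP => i; rewrite ffunE. Qed.

Fact exponentD_ge0 (r s : exponent) : [forall i, 0 <= (val r + val s) i].
Proof.
apply/forallP => i; rewrite ffunE addr_ge0 //.
- exact: (forallP (exponent_ge0 r)).
- exact: (forallP (exponent_ge0 s)).
Qed.

Definition exponent0 := Exponent exponent0_ge0.
Definition exponentD (r s : exponent) := Exponent (exponentD_ge0 r s).

Fact exponentDA : associative exponentD.
Proof. by move=> r s t; apply/val_inj/addrA. Qed.

Fact exponentDC : commutative exponentD.
Proof. by move=> r s; apply/val_inj/addrC. Qed.

Fact exponent0D : left_id exponent0 exponentD.
Proof. by move=> r; apply/val_inj/add0r. Qed.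

Fact exponentD0 : right_id exponent0 exponentD.
Proof. by move=> r; apply/val_inj/addr0. Qed.

Fact exponentD_eq0 r s :
  exponentD r s = exponent0 -> r = exponent0 /\ s = exponent0.
Proof.
move=> rs0; suff rs i : r i = 0 /\ s i = 0.
  by split; apply/val_inj/ffunP => i; rewrite ffunE; case: (rs i).
have /(congr1 val)/ffunP/(_ i)/eqP := rs0.
have r_ge0 := forallP (exponent_ge0 r) i.
have s_ge0 := forallP (exponent_ge0 s) i.
by rewrite /= !ffunE paddr_eq0 // => /andP[/eqP ? /eqP].
Qed.

HB.instance Definition _ := Choice_isMonomialDef.Build exponent
  exponentDA exponent0D exponentD0 exponentD_eq0.
HB.instance Definition _ := MonomialDef_isConomialDef.Build exponent exponentDC.

End Exponent.

Section Ideals.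
Context (S : comPzRingType).

Definition is_ideal (I : set S) : Prop :=
  [/\ I 0, forall f g, I f -> I g -> I (f + g) & forall a f, I f -> I (a * f)].

Definition ideal_gen (G : set S) : set S := smallest is_ideal G.

Definition ideal_sum (n : nat) (F : 'I_n -> set S) : set S :=
  [set f | exists2 g : 'I_n -> S, (forall j, F j (g j)) & f = \sum_j g j].

End Ideals.

Section MonomialIdeals.
Context (A : comPzRingType) (R : realType) (d : nat).

Definition real_polys : comPzRingType := monoid_ring A (exponent R d).

Definition monomial (r : exponent R d) : real_polys := << 1 *g r >>.

Definition monomial_ideal (I : set real_polys) : Prop :=
  exists E : set (exponent R d), I = ideal_gen (monomial @` E).

Definition m_irreducible (I : set real_polys) : Prop :=
  monomial_ideal I /\
  forall J K : set real_polys, monomial_ideal J -> monomial_ideal K ->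
    I = J `&` K -> I = J \/ I = K.

Definition has_finite_m_irreducible_decomposition (I : set real_polys) : Prop :=
  exists (n : nat) (F : 'I_n -> set real_polys),
    (forall l, m_irreducible (F l)) /\ I = \bigcap_l F l.

(* [eps = true] stands for 1 in Z/2.  As r is real, both comparisons are false
   when a = +oo. *)
Definition geq_eps (eps : bool) (r : R) (a : \bar R) : bool :=
  if eps then (a < r%:E)%E else (a <= r%:E)%E.

(* Since X_i^oo = 0, letting r range over vectors with infinite entries as well
   would only add 0 to the generators. *)
Definition corner_ideal (alpha : 'I_d -> \bar R) (eps : 'I_d -> bool) :
    set real_polys :=
  ideal_gen (monomial @`
    [set r : exponent R d | forall i, geq_eps (eps i) (r i) (alpha i)]).

Definition almost_finitely_generated (I : set real_polys) : Prop :=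
  exists (n : nat) (alpha : 'I_n -> 'I_d -> \bar R) (eps : 'I_n -> 'I_d -> bool),
    (forall j i, (0 <= alpha j i)%E) /\
    I = ideal_sum (fun j => corner_ideal (alpha j) (eps j)).

End MonomialIdeals.

(* Main.v *)
Require Import Defs.
From mathcomp Require Import all_boot all_order all_algebra.
From mathcomp Require Import finmap xfinmap monalg.
From mathcomp Require Import boolp classical_sets reals constructive_ereal.

(** A monomial ideal consists of the polynomials whose support lies in some
    up-closed set U of exponents ([monomial_idealP]), and when A is nonzero U is
    determined by the ideal ([supported_in_inj]).  Intersections of ideals become
    intersections of up-sets, sums become unions, and the ideals I_(alpha,eps)
    become the boxes {r | S_i contains r_i for all i} with each S_i an up-closed
    set of reals ([up_closed_threshold]).  So almost finitely generated ideals
    correspond to finite unions of boxes.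

    The m-irreducible ideals correspond to the up-sets U that are join-prime: if
    U contains the join of x and y, it contains x or y
    ([m_irreducible_supported_in]).  As r is the join of its projections to the
    coordinate axes, a join-prime U either contains 0, and is then everything,
    or contains r exactly when it contains one of these projections.  In the
    second case U is a cobox {r | S_i contains r_i for some i}
    ([join_prime_cobox]); conversely every cobox is join-prime, because the real
    line is totally ordered.

    Boxes are finite intersections, and coboxes finite unions, of the same
    half-spaces {r | S_i contains r_i}.  Distributivity therefore turns a finite
    intersection of coboxes into a finite union of boxes
    ([finite_union_of_boxes_bigcap]) and vice versa
    ([finite_union_of_boxes_bigcap_cobox]), which proves both implications.

    Over the zero ring, where the up-set is not determined by the ideal, there is
    a single ideal, the unit ideal, and it satisfies both conditions. *)

(** * Up-sets of exponents *)

Section ExponentOrder.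
Set Implicit Arguments.
Unset Strict Implicit.
Import Order.TTheory GRing.Theory Num.Theory.
Local Open Scope ring_scope.
Local Open Scope classical_set_scope.
Context (R : realType) (d : nat).
Implicit Types (r s x y : exponent R d) (U : set (exponent R d)).

Definition exponent_le r s := forall i, r i <= s i.

Definition upset U := forall r s, exponent_le r s -> U r -> U s.

Fact clip_ge0 (f : 'I_d -> R) :
  [forall i, 0 <= [ffun j => Num.max 0 (f j)] i].
Proof. by apply/forallP => i; rewrite ffunE le_max lexx. Qed.

(** Truncating at 0 makes an exponent of any function, so that joins,
    differences and points on the axes need no proof of nonnegativity. *)
Definition clip (f : 'I_d -> R) : exponent R d := Exponent (clip_ge0 f).

Lemma clipE f i : clip f i = Num.max 0 (f i).
Proof. by rewrite ffunE. Qed.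

Lemma exponent_nonneg r i : 0 <= r i.
Proof. exact: (forallP (exponent_ge0 r)). Qed.

Lemma exponent_le_refl r : exponent_le r r.
Proof. by move=> i. Qed.

Lemma exponentDE r s i : exponentD r s i = r i + s i.
Proof. by rewrite ffunE. Qed.

Lemma exponent_le_addl r s : exponent_le s (exponentD r s).
Proof. by move=> i; rewrite exponentDE lerDr exponent_nonneg. Qed.

(** The order on exponents is divisibility of monomials. *)
Lemma exponent_leP r s : exponent_le r s -> exists t, s = exponentD t r.
Proof.
move=> rs; exists (clip (fun i => s i - r i)).
apply/val_inj/ffunP => i.
change (s i = exponentD (clip (fun i => s i - r i)) r i).
by rewrite exponentDE clipE max_r ?subr_ge0 // subrK.
Qed.

Definition exponent_join r s := clip (fun i => Num.max (r i) (s i)).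

Lemma exponent_joinE r s i : exponent_join r s i = Num.max (r i) (s i).
Proof. by rewrite clipE max_r // le_max exponent_nonneg. Qed.

Lemma exponent_le_joinl r s : exponent_le r (exponent_join r s).
Proof. by move=> i; rewrite exponent_joinE le_max lexx. Qed.

Lemma exponent_le_joinr r s : exponent_le s (exponent_join r s).
Proof. by move=> i; rewrite exponent_joinE le_max lexx orbT. Qed.

Lemma exponent_join_le r s x :
  exponent_le r x -> exponent_le s x -> exponent_le (exponent_join r s) x.
Proof. by move=> rx sx i; rewrite exponent_joinE ge_max rx sx. Qed.

Definition axis (i : 'I_d) (t : R) := clip (fun j => if j == i then t else 0).

Lemma axisE i t j : axis i t j = if j == i then Num.max 0 t else 0.
Proof. by rewrite clipE; case: eqP => // _; rewrite maxxx. Qed.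

Lemma axis_le i t u : t <= u -> exponent_le (axis i t) (axis i u).
Proof.
move=> tu j; rewrite !axisE; case: eqP => // _.
by rewrite ge_max !le_max lexx tu orbT.
Qed.

Lemma le_join_axis r :
  exponent_le r (\big[exponent_join/exponent0 R d]_i axis i (r i)).
Proof.
move=> i; have := mem_index_enum i; elim: index_enum => [//|j e IH].
rewrite inE big_cons exponent_joinE le_max => /predU1P[->|/IH ->]; last first.
  by rewrite orbT.
by rewrite axisE eqxx le_max lexx orbT.
Qed.

Definition join_prime U := forall x y, U (exponent_join x y) -> U x \/ U y.

Definition up_closed (S : set R) := forall a b, a <= b -> S a -> S b.

Definition box (S : 'I_d -> set R) : set (exponent R d) :=
  [set r | forall i, S i (r i)].

Definition cobox (S : 'I_d -> set R) : set (exponent R d) :=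
  [set r | exists i, S i (r i)].

Lemma box_upset S : (forall i, up_closed (S i)) -> upset (box S).
Proof. by move=> Sup r s rs Sr i; apply: Sup (rs i) (Sr i). Qed.

Lemma cobox_upset S : (forall i, up_closed (S i)) -> upset (cobox S).
Proof. by move=> Sup r s rs [i Sr]; exists i; apply: Sup (rs i) Sr. Qed.

(** In a total order the maximum of x_i and y_i is one of the two. *)
Lemma cobox_join_prime S : join_prime (cobox S).
Proof.
move=> x y [i]; rewrite exponent_joinE.
by case: leP => _ Si; [right|left]; exists i.
Qed.

(** Every r is the join of the points [axis i (r i)].  Applying primality along
    this join, which starts from 0, leaves one axis point in U; the trace of U
    on the axes is thus all that matters. *)
Lemma join_prime_cobox U : upset U -> join_prime U -> ~ U (exponent0 R d) ->
  U = cobox (fun i => [set t | U (axis i t)]).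
Proof.
move=> Uup Upr U0; apply/seteqP; split => r; last first.
  move=> [i] /=; apply: Uup => j; rewrite axisE max_r ?exponent_nonneg //.
  by case: eqP => [->//|_]; apply: exponent_nonneg.
move=> /(Uup _ _ (le_join_axis r)).
elim/big_ind: _ => [/U0//|x y IHx IHy /Upr[/IHx//|/IHy//]|i _ Ui].
by exists i.
Qed.

(** Indexing by an arbitrary finite type lets choice functions serve as indices
    when unions and intersections are exchanged. *)
Definition finite_union_of_boxes U :=
  exists (T : finType) (S : T -> 'I_d -> set R),
    (forall t i, up_closed (S t i)) /\ U = \bigcup_t box (S t).

Lemma finite_union_of_boxes_setT : finite_union_of_boxes setT.
Proof.
exists unit, (fun _ _ => setT); split=> //.
by apply/seteqP; split => // r _; exists tt.
Qed.

(** The box for the index i restricts only the coordinate i. *)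
Lemma finite_union_of_boxes_cobox S :
  (forall i, up_closed (S i)) -> finite_union_of_boxes (cobox S).
Proof.
move=> Sup; exists 'I_d, (fun i j => if j == i then S i else setT); split.
  by move=> i j; case: eqP.
apply/seteqP; split => r [i].
  by move=> Si; exists i => // j; case: eqP => // ->.
by move=> _ /(_ i); rewrite eqxx; exists i.
Qed.

(** By distributivity, the boxes of the intersection are indexed by the functions
    that choose one box of each [F l], and an intersection of boxes is a box. *)
Lemma finite_union_of_boxes_bigcap n (F : 'I_n -> set (exponent R d)) :
  (forall l, finite_union_of_boxes (F l)) ->
  finite_union_of_boxes (\bigcap_l F l).
Proof.
move=> Fbox; pose T l := projT1 (cid (Fbox l)).
have Tbox l : exists S : T l -> 'I_d -> set R,
    (forall t i, up_closed (S t i)) /\ F l = \bigcup_t box (S t).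
  exact: projT2 (cid (Fbox l)).
pose S l := projT1 (cid (Tbox l)).
have TS l : (forall t i, up_closed (S l t i)) /\ F l = \bigcup_t box (S l t).
  exact: projT2 (cid (Tbox l)).
exists {dffun forall l, T l},
  (fun (phi : {dffun forall l, T l}) i => \bigcap_l S l (phi l) i); split.
  move=> phi i a b ab Sa l _; have [Sup _] := TS l.
  exact: Sup ab (Sa l I).
apply/seteqP; split => r.
  move=> Fr; have phiP l : {t | box (S l t) r}.
    by apply: cid; have := Fr l I; have [_ ->] := TS l => -[t _ St]; exists t.
  exists [ffun l => projT1 (phiP l)] => // i l _; rewrite ffunE.
  exact: (projT2 (phiP l)).
move=> [phi _ phir] l _; have [_ ->] := TS l.
by exists (phi l) => // i; apply: phir.
Qed.

(** A point avoids every box exactly when some [phi] picks, for each box, a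
    coordinate where the point fails its constraint.  For a fixed [phi], the
    points that meet at least one of the picked constraints form a cobox, since
    the constraints picked on the same coordinate can be merged into one. *)
Lemma finite_union_of_boxes_bigcap_cobox U : finite_union_of_boxes U ->
  exists (T : finType) (S : T -> 'I_d -> set R),
    (forall t i, up_closed (S t i)) /\ U = \bigcap_t cobox (S t).
Proof.
move=> [T [S [Sup ->]]].
exists {ffun T -> 'I_d},
  (fun (phi : {ffun T -> 'I_d}) i => [set a | exists t, phi t = i /\ S t i a]).
split=> [phi i a b ab [t [ti Sa]]|].
  by exists t; split=> //; apply: Sup Sa.
apply/seteqP; split => r.
  by move=> [t _ Sr] phi _; exists (phi t), t.
move=> H; apply: contrapT => nU.
have /choice[phi phiP] t : exists i, ~ S t i (r i).
  by apply/existsNP => Sr; apply: nU; exists t.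
have [i [t []]] := H [ffun t => phi t] I.
by rewrite ffunE => <-; apply: phiP.
Qed.

(** The threshold is the infimum of the nonnegative part of [S], strict when [S]
    does not contain it, and infinite when that part is empty. *)
Lemma up_closed_threshold (S : set R) : up_closed S ->
  exists (a : \bar R) (eps : bool),
    (0 <= a)%E /\ forall r : R, 0 <= r -> S r <-> geq_eps eps r a.
Proof.
move=> Sup; pose P := [set r : R | 0 <= r /\ S r].
have [[p Pp]|Pempty] := pselect (P !=set0); last first.
  exists +oo%E, false; split=> [|r r0]; first exact: leey.
  by split=> // Sr; case: Pempty; exists r.
have lb0 : lbound P 0 by move=> r [].
have Pinf : has_inf P by split; [exists p|exists 0].
have leP (r : R) : 0 <= r -> S r -> inf P <= r.
  by move=> r0 Sr; apply: ge_inf; [exists 0|split].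
exists (inf P)%:E, (~~ `[< S (inf P) >]); split.
  by rewrite lee_fin; apply: lb_le_inf; [exists p|].
move=> r r0; rewrite /geq_eps; case: asboolP => Sinf /=.
  by rewrite lee_fin; split=> [/leP->//|/Sup]; apply.
rewrite lte_fin; split=> [Sr|rlt].
  rewrite lt_neqAle leP // andbT; apply/eqP => e.
  by apply: Sinf; rewrite e.
have [|q [_ Sq]] := inf_adherent _ Pinf (eps := r - inf P).
  by rewrite subr_gt0.
by rewrite addrC subrK => /ltW/Sup; apply.
Qed.

Lemma geq_eps_up_closed eps (a : \bar R) :
  up_closed [set r : R | geq_eps eps r a].
Proof.
move=> r s rs; rewrite /geq_eps /=; case: eps => ar.
  by apply: lt_le_trans ar _; rewrite lee_fin.
by apply: le_trans ar _; rewrite lee_fin.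
Qed.

End ExponentOrder.

(** * Monomial ideals as up-sets *)

Section MonomialIdeals.
Set Implicit Arguments.
Unset Strict Implicit.
Import Order.TTheory GRing.Theory Num.Theory.
Local Open Scope ring_scope.
Local Open Scope classical_set_scope.
Context (R : realType) (A : comPzRingType) (d : nat).
Implicit Types (r s x y : exponent R d) (U V W : set (exponent R d)).

Definition supported_in U : set (real_polys A R d) :=
  [set f : {malg A[exponent R d]} | forall r, f@_r != 0 -> U r].

Lemma supported_in_term U (a : A) r : (a != 0 -> U r) ->
  supported_in U << a *g r >>.
Proof.
move=> Ur s; rewrite mcoeffU; case: (eqVneq r s) => [<-//|_].
by rewrite mulr0n eqxx.
Qed.

Lemma supported_in0 U : supported_in U 0.
Proof. by move=> r; rewrite mcoeff0 eqxx. Qed.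

Lemma supported_inD U f g :
  supported_in U f -> supported_in U g -> supported_in U (f + g).
Proof.
move=> fU gU r; rewrite mcoeffD => fg; case: (eqVneq f@_r 0) => [f0|/fU//].
by apply: gU; rewrite f0 add0r in fg.
Qed.

Lemma supported_in_sum U (K : eqType) (e : seq K) (F : K -> real_polys A R d) :
  (forall k, k \in e -> supported_in U (F k)) ->
  supported_in U (\sum_(k <- e) F k).
Proof.
move=> FU; rewrite big_seq; apply: big_ind => //; first exact: supported_in0.
exact: supported_inD.
Qed.

Lemma supported_in_ideal U : upset U -> is_ideal (supported_in U).
Proof.
move=> Uup; split; [exact: supported_in0|exact: supported_inD|].
move=> f g gU; apply: supported_in_sum => k _.
apply: supported_in_sum => l lg; apply: supported_in_term => _.
apply: (Uup l); first exact: exponent_le_addl.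
by apply: gU; rewrite mcoeff_neq0.
Qed.

Lemma is_ideal_sum (S : comPzRingType) (J : set S) (K : eqType) (e : seq K)
    (F : K -> S) :
  is_ideal J -> (forall k, k \in e -> J (F k)) -> J (\sum_(k <- e) F k).
Proof. by move=> [J0 JD _] FJ; rewrite big_seq; apply: big_ind. Qed.

Lemma termE (f : {malg A[exponent R d]}) :
  f = \sum_(k <- msupp f) (<< f@_k *g k >> : real_polys A R d)
    :> real_polys A R d.
Proof. exact: monalgE. Qed.

Lemma supported_in_sub U (J : set (real_polys A R d)) :
  is_ideal J -> (forall (a : A) r, U r -> J << a *g r >>) ->
  supported_in U `<=` J.
Proof.
move=> Jid UJ f fU; rewrite [f]termE; apply: is_ideal_sum => // k.
by rewrite -mcoeff_neq0 => /fU; apply: UJ.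
Qed.

(** The terms of a polynomial supported above [E] are multiples of monomials with
    exponent in [E]. *)
Lemma ideal_genE (E : set (exponent R d)) :
  ideal_gen (@monomial A R d @` E) =
  supported_in [set r | exists2 e, E e & exponent_le e r].
Proof.
apply/seteqP; split.
  apply: smallest_sub.
    apply: supported_in_ideal => r s rs [e Ee er]; exists e => // i.
    exact: le_trans (rs i).
  move=> _ [e Ee <-]; apply: supported_in_term => _.
  by exists e => //; apply: exponent_le_refl.
move=> f fE J [Jid EJ]; move: f fE; apply: supported_in_sub => // a r [e Ee].
move=> /exponent_leP[t ->].
have -> : << a *g exponentD t e >> =
    (<< a *g t >> : real_polys A R d) * monomial A e.
  by rewrite -[RHS]/(mring_mul _ _) mring_mulUU mulr1.
by have [_ _ JM] := Jid; apply/JM/EJ; exists e.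
Qed.

Lemma ideal_gen_upset U : upset U ->
  ideal_gen (@monomial A R d @` U) = supported_in U.
Proof.
move=> Uup; rewrite ideal_genE; congr supported_in; apply/seteqP; split => r.
  by move=> [e Ue /Uup]; apply.
by exists r => //; apply: exponent_le_refl.
Qed.

Lemma monomial_idealP (J : set (real_polys A R d)) :
  monomial_ideal J <-> exists2 U, upset U & J = supported_in U.
Proof.
split=> [[E ->]|[U Uup ->]]; last by exists U; rewrite ideal_gen_upset.
rewrite ideal_genE; eexists; last by reflexivity.
move=> r s rs [e Ee er]; exists e => // i; exact: le_trans (rs i).
Qed.

Lemma supported_in_bigcap K (U : K -> set (exponent R d)) :
  supported_in (\bigcap_k U k) = \bigcap_k supported_in (U k).
Proof.
apply/seteqP; split => f fU; first by move=> k _ r /fU; apply.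
by move=> r fr k _; apply: fU.
Qed.

Lemma supported_inI U V :
  supported_in (U `&` V) = supported_in U `&` supported_in V.
Proof.
apply/seteqP; split => f; first by move=> fU; split=> r /fU[].
by move=> [fU fV] r fr; split; [apply: fU|apply: fV].
Qed.

(** The sum is an ideal, so it is enough to place each single term with exponent
    in [U j] into the j-th summand. *)
Lemma ideal_sum_supported_in n (U : 'I_n -> set (exponent R d)) :
  (forall j, upset (U j)) ->
  ideal_sum (fun j => supported_in (U j)) = supported_in (\bigcup_j U j).
Proof.
move=> Uup; apply/seteqP; split.
  move=> _ [g gU ->]; apply: supported_in_sum => j _ r /gU.
  by exists j.
apply: supported_in_sub => [|a r [j _ Ujr]].
  split.
  - by exists (fun=> 0) => [j|]; [exact: supported_in0|rewrite big1].
  - move=> _ _ [f fU ->] [g gU ->]; exists (fun j => f j + g j).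
      by move=> j; apply: supported_inD.
    by rewrite big_split.
  - move=> a _ [g gU ->]; exists (fun j => a * g j); last by rewrite mulr_sumr.
    by move=> j; have [_ _] := supported_in_ideal (Uup j); apply.
exists (fun k => if k == j then << a *g r >> else 0).
  move=> k; case: eqP => [->|_]; last exact: supported_in0.
  exact: supported_in_term.
by rewrite -big_mkcond big_pred1_eq.
Qed.

(** * The two kinds of decomposition *)

Lemma almost_finitely_generatedP (J : set (real_polys A R d)) :
  almost_finitely_generated J <->
  exists2 U, finite_union_of_boxes U & J = supported_in U.
Proof.
have cornerE (alpha : 'I_d -> \bar R) eps : corner_ideal alpha eps =
    supported_in (box (fun i => [set t | geq_eps (eps i) t (alpha i)])).
  apply: ideal_gen_upset.
  by apply: (box_upset (S := fun i => [set t | geq_eps (eps i) t (alpha i)]))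
    => i; apply: geq_eps_up_closed.
split=> [[n [alpha [eps [_ ->]]]]|[U [T [S [Sup ->]]] ->]].
  pose S j i := [set t | geq_eps (eps j i) t (alpha j i)].
  have Sup j i : up_closed (S j i) by apply: geq_eps_up_closed.
  exists (\bigcup_j box (S j)); first by exists 'I_n, S.
  rewrite -ideal_sum_supported_in; last by move=> j; apply: box_upset.
  by congr ideal_sum; apply/funext => j; rewrite cornerE.
have /choice[alpha] t : exists al : 'I_d -> \bar R, exists eps : 'I_d -> bool,
    forall i, (0 <= al i)%E /\
      forall r : R, 0 <= r -> S t i r <-> geq_eps (eps i) r (al i).
  have /choice[al /choice[eps]] i := up_closed_threshold (Sup t i).
  by exists al, eps.
move=> /choice[eps] aeP.
have boxE t : box (S t) =
    box (fun i => [set u | geq_eps (eps t i) u (alpha t i)]).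
  by apply/seteqP; split => r Sr i; have [_ /(_ (r i))] := aeP t i;
    move=> /(_ (exponent_nonneg r i)) H; apply/H/Sr.
exists #|T|, (fun j => alpha (enum_val j)), (fun j => eps (enum_val j)).
split=> [j i|]; first by have [] := aeP (enum_val j) i.
rewrite (_ : \bigcup_t box (S t) = \bigcup_(j : 'I_#|T|) box (S (enum_val j))).
  rewrite -ideal_sum_supported_in; last by move=> j; apply: box_upset.
  by congr ideal_sum; apply/funext => j; rewrite cornerE boxE.
apply/seteqP; split => r [t _ Sr]; last by exists (enum_val t).
by exists (enum_rank t) => //; rewrite enum_rankK.
Qed.

Section NonzeroCoefficients.
Context (A_neq0 : (1 : A) != 0).

Lemma supported_in_inj U V : supported_in U = supported_in V -> U = V.
Proof.
suff sub U' V' : supported_in U' = supported_in V' -> U' `<=` V'.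
  by move=> UV; apply/seteqP; split; apply: sub.
move=> UV r Ur.
have : supported_in V' (monomial A r) by rewrite -UV; apply: supported_in_term.
by move/(_ r); rewrite mcoeffUU; apply.
Qed.

(** If the join of [x] and [y] lies in [U], then [U] is the intersection of the
    up-sets obtained by adjoining to it everything above [x], respectively
    everything above [y].  Conversely, if [U] is the intersection of [V] and [W]
    with [v] in [V] outside [U], the join of [v] with any [w] in [W] lies in [U],
    and primality puts [w] in [U]. *)
Lemma m_irreducible_supported_in U : upset U ->
  m_irreducible (supported_in U) <-> join_prime U.
Proof.
move=> Uup; split=> [[_ irr] x y Uxy|Upr].
  have up z : upset (U `|` [set r | exponent_le z r]).
    move=> r s rs [/(Uup _ _ rs) Us|zr]; [by left|right=> i].
    exact: le_trans (rs i).
  pose Ux z := U `|` [set r | exponent_le z r].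
  have mon z : monomial_ideal (supported_in (Ux z)).
    by apply/monomial_idealP; exists (Ux z) => //; apply: up.
  have UxI : U = Ux x `&` Ux y.
    apply/seteqP; split => r; first by move=> Ur; split; left.
    by move=> [[//|xr] [//|yr]]; apply: Uup Uxy; apply: exponent_join_le.
  have Uz z : Ux z z by right; apply: exponent_le_refl.
  have := irr _ _ (mon x) (mon y); rewrite -supported_inI -UxI => /(_ erefl).
  by case=> /supported_in_inj ->; [left|right].
split; first by apply/monomial_idealP; exists U.
move=> _ _ /monomial_idealP[V Vup ->] /monomial_idealP[W Wup ->].
rewrite -supported_inI => /supported_in_inj UVW.
have [VU|/existsNP[v /not_implyP[Vv nUv]]] := pselect (V `<=` U).
  by left; congr supported_in; apply/seteqP; split=> //; rewrite UVW => r [].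
right; congr supported_in; apply/seteqP; split; first by rewrite UVW => r [].
move=> w Ww; have /Upr[/nUv|] // : U (exponent_join v w).
rewrite UVW; split; first exact: Vup (exponent_le_joinl v w) Vv.
exact: Wup (exponent_le_joinr v w) Ww.
Qed.

Lemma m_irreducible_finite_union_of_boxes (J : set (real_polys A R d)) :
  m_irreducible J ->
  exists2 U, finite_union_of_boxes U & J = supported_in U.
Proof.
move=> Jirr; have [/monomial_idealP[U Uup JU] _] := Jirr.
exists U => //; move: Jirr; rewrite JU => /(m_irreducible_supported_in Uup) Upr.
have [U0|/(join_prime_cobox Uup Upr) ->] := pselect (U (exponent0 R d)).
  rewrite (_ : U = setT); first exact: finite_union_of_boxes_setT.
  apply/seteqP; split => // r _; apply: Uup U0 => i.
  by rewrite ffunE exponent_nonneg.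
apply: finite_union_of_boxes_cobox => i a b ab; apply: Uup.
exact: axis_le.
Qed.

Lemma m_irreducible_decompositionP (J : set (real_polys A R d)) :
  has_finite_m_irreducible_decomposition J <->
  exists2 U, finite_union_of_boxes U & J = supported_in U.
Proof.
split=> [[n [F [Firr ->]]]|[U]].
  have /choice[U UP] l :
      exists U, finite_union_of_boxes U /\ F l = supported_in U.
    by have [U] := m_irreducible_finite_union_of_boxes (Firr l); exists U.
  exists (\bigcap_l U l).
    by apply: finite_union_of_boxes_bigcap => l; have [] := UP l.
  by rewrite supported_in_bigcap; apply: eq_bigcapr => l _; have [] := UP l.
move=> /finite_union_of_boxes_bigcap_cobox[T [S [Sup ->]]] ->.
exists #|T|, (fun j => supported_in (cobox (S (enum_val j)))); split.
  move=> j; apply/m_irreducible_supported_in; first exact: cobox_upset.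
  exact: cobox_join_prime.
rewrite supported_in_bigcap; apply/seteqP; split => f H t _; first exact: H.
by rewrite -(enum_rankK t); apply: H.
Qed.

End NonzeroCoefficients.

Lemma zero_ring_ideal (J : set (real_polys A R d)) :
  (1 : A) = 0 -> J 0 -> J = setT.
Proof.
move=> A0 J0; apply/seteqP; split => // f _.
suff -> : f = 0 by [].
apply: (iffLR (malgP (f : {malg A[exponent R d]}) 0)) => k.
by rewrite mcoeff0 -[LHS]mulr1 A0 mulr0.
Qed.

Lemma zero_ring_decompositions (J : set (real_polys A R d)) :
  (1 : A) = 0 -> monomial_ideal J ->
  has_finite_m_irreducible_decomposition J /\ almost_finitely_generated J.
Proof.
move=> A0 /monomial_idealP[U _ ->].
have full V : supported_in V = setT.
  by apply: zero_ring_ideal => //; apply: supported_in0.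
split; last first.
  apply/almost_finitely_generatedP; exists setT; last by rewrite !full.
  exact: finite_union_of_boxes_setT.
exists 0%N, (fun=> setT); split=> [[]//|].
by rewrite full; apply/seteqP; split=> // f _ [].
Qed.

End MonomialIdeals.

Theorem theorem1p2 (R : realType) (A : comPzRingType) (d : nat)
  (I : set (real_polys A R d)) (hI : monomial_ideal I) :
  has_finite_m_irreducible_decomposition I <-> almost_finitely_generated I.
Proof.
case: (eqVneq (1%R : A) 0%R) => [A0|A1].
  by have [dec afg] := zero_ring_decompositions A0 hI.
exact: (iff_trans (m_irreducible_decompositionP A1 I)
                  (iff_sym (almost_finitely_generatedP I))).
Qed.
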